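(* There exist absolute constants $c_1,c_2,C>0$ and $q_0$ such that the following holds. Let $q\ge q_0$ be a square-free integer satisfying $$\sum_{p\mid q}\frac{\log p}{p}\ \ge\ 60\log\log\log q,$$ and define $z:=\big(\prod_{p\mid q}p^{1/p}\big)^{c_1}$. If $u$ is a real number with $\sqrt z\ge u\ge C(\log\log q/\log z)^3$, then there exist intervals $I_+$ and $I_-$ of length at least $z^u$ such that $$\sum_{n\in I_+,\ (n,q)=1}1\ \ge\ \Big\{1+\frac1{u^{c_2u}}\Big\}\frac{\phi(q)}{q}|I_+|\qquad\text{and}\qquad \sum_{n\in I_-,\ (n,q)=1}1\ \le\ \Big\{1-\frac1{u^{c_2u}}\Big\}\frac{\phi(q)}{q}|I_-|.$$
   Context: Sums and products over $p\mid q$ run over the primes $p$ dividing $q$; sums over $n\in I_\pm$ run over integers; $\phi$ is Euler's totient function; $|I|$ is the length of the interval $I$. *)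

(* Defs.v *)
From mathcomp Require Import all_boot all_order all_algebra.
From mathcomp Require Import all_classical all_reals all_analysis.
Set Implicit Arguments.
Unset Strict Implicit.
Unset Printing Implicit Defensive.
Import Order.TTheory GRing.Theory Num.Theory.
Local Open Scope classical_set_scope.
Local Open Scope ring_scope.

Definition squarefree (q : nat) : Prop :=
  forall d : nat, (d ^ 2 %| q)%N -> d = 1%N.

Section SievedIntervals.
Context {R : realType}.

Definition zparam (c1 : R) (q : nat) : R :=
  (\prod_(p <- primes q) p%:R `^ p%:R^-1) `^ c1.

(* The length is extended-real: it is +oo on unbounded intervals. *)
Definition itv_length (I : interval R) : \bar R :=
  lebesgue_measure ([set` I] : set R).

(* Finitely supported sum: it is only meaningful for bounded I, since
   \sum_(_ \in _) returns 0 when the support is infinite. *)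
Definition coprime_count (q : nat) (I : interval R) : R :=
  \sum_(n \in [set n : int | n%:~R \in I /\ coprimez n q%:Z]) (1 : R).

End SievedIntervals.

(* Main.v *)
Require Import Defs.
From mathcomp Require Import all_boot all_order all_algebra.
From mathcomp Require Import all_classical all_reals all_analysis.
From mathcomp Require Import ring lra zify.
Import Order.TTheory GRing.Theory Num.Theory.
Local Open Scope classical_set_scope.
Local Open Scope ring_scope.

(** Truncating Legendre's inclusion-exclusion produces the irregularity. Let P
    be a finite set of primes in a short range [y, Y], let l be their product,
    s = \sum_(p in P) 1/p, and let e_j be the j-th elementary symmetric sum of
    the 1/p. For x = y ^ k a product of k primes of P is at least x, so

      #{1 <= n < x, (n, l) = 1}
        = x \sum_(j < k) (-1)^j e_j + O(\sum_(j < k) Y^j e_j),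

    whereas the expected count is the full alternating sum
    x \prod_(p in P) (1 - 1/p) = x \sum_j (-1)^j e_j. By Bonferroni the omitted
    tail has the sign (-1)^k and absolute value at least e_k - e_(k+1), hence at
    least e_k / 2 because e_(k+1) <= s e_k / (k+1) and s is bounded. When y is
    large compared with (Y / y)^k k / s, the rounding errors are below
    x e_k / 4. So the count deviates from its expectation by a proportion at least
    e_k / 4 >= (s / 2k)^k / 4, upwards for odd k and downwards for even k
    ([sieve_deviation]).

    If l m = q is squarefree, averaging over the shifts of the interval by the
    multiples l t, 0 <= t < m, multiplies both the count and its expectation by
    phi(m) / m, since l t + n runs over all residues mod m. Some shift is at
    least, and some shift at most, the average, so the deviation passes
    from l to q ([interval_deviation]).

    It remains to find P among the prime factors of q. Put L = ln ln q and
    S = \sum_(p | q) ln p / p, so that ln z = c1 S. Primes with ln p <= S / 8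
    contribute at most S / 4 to S (compare with the factorization of n!), and
    primes above (ln q)^2 contribute O(1), as q has O(ln q) prime factors. Hence
    primes with S / 8 < ln p <= 2 L carry half of S, and \sum 1/p over them is at
    least S / 4L. Cut this range of ln p into blocks of length eta = S / 64u;
    some block has s >= u^-3 ([exists_block]). The hypotheses on u enter twice:
    u >= C (L / ln z)^3 makes u large and bounds L / S, hence the number of
    blocks, by a power of u; and u <= sqrt z makes every needed power of u
    smaller than y >= expR (S / 16), because c1 is small. Taking
    u / 4 <= k <= u / 2 of either parity makes the length y ^ k at least z ^ u
    and the proportion (s / 2k)^k / 4 at least u ^ (- 3 u). *)

(** * Elementary symmetric sums and Bonferroni's inequalities *)

(** The recursion on [xs] mirrors the sieving by one more prime, so that the
    estimates below follow by induction on the list of primes. *)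
Fixpoint elemsym {R : realFieldType} (xs : seq R) (k : nat) : R :=
  match xs, k with
  | [::], 0 => 1
  | [::], _.+1 => 0
  | _ :: _, 0 => 1
  | x :: xs', k'.+1 => elemsym xs' k'.+1 + x * elemsym xs' k'
  end.

Definition altsum {R : realFieldType} (xs : seq R) (k : nat) : R :=
  \sum_(0 <= j < k) (-1) ^+ j * elemsym xs j.

Lemma elemsym0 {R : realFieldType} (xs : seq R) : elemsym xs 0 = 1.
Proof. by case: xs. Qed.

Lemma elemsym_ge0 {R : realFieldType} (xs : seq R) (k : nat) :
  all (fun x => 0 <= x) xs -> 0 <= elemsym xs k.
Proof.
elim: xs k => [|x xs IH] [|k] //= /andP[x0 xs0].
by rewrite addr_ge0 ?mulr_ge0 ?IH.
Qed.

Lemma altsumS {R : realFieldType} (xs : seq R) (k : nat) :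
  altsum xs k.+1 = altsum xs k + (-1) ^+ k * elemsym xs k.
Proof. by rewrite /altsum big_nat_recr. Qed.

Lemma altsum_cons {R : realFieldType} (x : R) (xs : seq R) (k : nat) :
  altsum (x :: xs) k.+1 = altsum xs k.+1 - x * altsum xs k.
Proof.
elim: k => [|k IH]; first by rewrite !altsumS /altsum !big_geq //= elemsym0; ring.
rewrite altsumS IH (altsumS xs k.+1) (altsumS xs k) /= exprS; ring.
Qed.

(** Splitting off one factor 1 - x turns the alternating remainder at rank
    k + 1 into the remainder at rank k + 1 plus x times the one at rank k, both
    of which have the right sign by induction. *)
Lemma bonferroni {R : realFieldType} (xs : seq R) (k : nat) :
  all (fun x => 0 <= x <= 1) xs ->
  0 <= (-1) ^+ k * (\prod_(x <- xs) (1 - x) - altsum xs k).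
Proof.
elim: xs k => [|x xs IH] [|k] /=.
- by rewrite big_nil /altsum big_geq // expr0; lra.
- move=> _; rewrite big_nil /altsum big_nat_recl // expr0 /=.
  by rewrite big1 => [|i _]; rewrite ?mulr0 // mul1r addr0 subrr mulr0.
- move=> /andP[/andP[x0 x1] xs01].
  rewrite expr0 mul1r /altsum big_geq // subr0.
  have xxs01 : all (fun y => 0 <= y <= 1) (x :: xs) by rewrite /= x0 x1.
  by rewrite big_seq prodr_ge0 // => y /(allP xxs01) /andP[_]; rewrite subr_ge0.
- move=> /andP[/andP[x0 x1] xs01].
  rewrite altsum_cons big_cons.
  have := IH k.+1 xs01; have := mulr_ge0 x0 (IH k xs01).
  rewrite exprS; nra.
Qed.

(** Two more terms of the alternating sum bring the remainder back to the
    sign (-1)^k, so it exceeds in absolute value the two terms split off. *)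
Lemma bonferroni_gap {R : realFieldType} (xs : seq R) (k : nat) :
  all (fun x => 0 <= x <= 1) xs ->
  elemsym xs k - elemsym xs k.+1 <=
    (-1) ^+ k * (\prod_(x <- xs) (1 - x) - altsum xs k).
Proof.
move=> /(bonferroni xs k.+2); rewrite !altsumS !exprS.
move: (elemsym _ _) (elemsym _ _) (altsum _ _) (\prod_(_ <- _) _) => a b c d.
by rewrite -signr_odd; case: (odd k); rewrite ?expr1 ?expr0; lra.
Qed.

(** Multiplying e_j by e_1 produces each product of j + 1 distinct entries
    j + 1 times, besides nonnegative terms with a repeated entry. *)
Lemma elemsym_le {R : realFieldType} (xs : seq R) (j : nat) :
  all (fun x => 0 <= x) xs ->
  j.+1%:R * elemsym xs j.+1 <= (\sum_(x <- xs) x) * elemsym xs j.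
Proof.
elim: xs j => [|x xs IH] j /=; first by rewrite big_nil mulr0 mul0r.
move=> /andP[x0 xs0]; rewrite big_cons.
have e0 := elemsym_ge0 xs _ xs0.
case: j => [|j].
  have := IH 0 xs0; rewrite !elemsym0; lra.
have h1 := IH j.+1 xs0; have h2 := ler_wpM2l x0 (IH j xs0).
have h3 := mulr_ge0 (mulr_ge0 x0 x0) (e0 j).
move: h1; rewrite -[j.+2%:R]natr1; nra.
Qed.

(** Among the entries by which a product of j entries can be extended, the
    j already used account for at most j m of the total. *)
Lemma elemsym_ge {R : realFieldType} (xs : seq R) (m : R) (j : nat) :
  all (fun x => 0 <= x <= m) xs ->
  (\sum_(x <- xs) x - j%:R * m) * elemsym xs j <= j.+1%:R * elemsym xs j.+1.
Proof.
elim: xs j => [|x xs IH] j /=.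
  move=> _; rewrite big_nil mulr0; case: j => [|j]; last by rewrite mulr0.
  by rewrite mul0r subr0 mul0r.
move=> /andP[/andP[x0 xm] xs0]; rewrite big_cons.
have e0 j' : 0 <= elemsym xs j'.
  by apply: elemsym_ge0; apply: sub_all xs0 => y /andP[].
case: j => [|j].
  have := IH 0 xs0; rewrite !elemsym0; lra.
have h1 := IH j.+1 xs0; have h2 := ler_wpM2l x0 (IH j xs0).
have h3 : 0 <= x * (m - x) * elemsym xs j.
  by rewrite !mulr_ge0 // subr_ge0.
move: h1 h2; rewrite -[j.+2%:R]natr1 -[j.+1%:R]natr1; nra.
Qed.

(** Since Y^j e_j at least doubles at each step, the sum is comparable to its
    last term; this keeps the rounding errors of the sieve below the main
    deviation. *)
Lemma elemsym_ratio_sum {R : realFieldType} (xs : seq R) (Y r : R) (k : nat) :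
  all (fun x => 0 <= x) xs -> 0 < r -> 2 * r <= Y ->
  (forall j, (j < k)%N -> elemsym xs j <= r * elemsym xs j.+1) ->
  Y * (\sum_(0 <= j < k) Y ^+ j * elemsym xs j) <= 2 * r * (Y ^+ k * elemsym xs k).
Proof.
move=> xs0 r0 rY; elim: k => [|k IH] hr.
  by rewrite big_geq // mulr0 expr0 mul1r elemsym0; lra.
have {}IH := IH (fun j hj => hr j (ltnW hj)).
have hk := hr k (ltnSn k).
have Yk : 0 <= Y ^+ k by rewrite exprn_ge0; lra.
have Yke : 0 <= Y ^+ k * elemsym xs k by rewrite mulr_ge0 ?elemsym_ge0.
rewrite big_nat_recr //= mulrDr exprS.
have h1 : Y * (Y ^+ k * elemsym xs k) <= Y * (Y ^+ k * (r * elemsym xs k.+1)).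
  by rewrite ler_wpM2l ?ler_wpM2l //; lra.
have h2 : 2 * r * (Y ^+ k * elemsym xs k) <= Y * (Y ^+ k * elemsym xs k).
  by rewrite ler_wpM2r.
lra.
Qed.

Lemma elemsym_ratio_ge {R : realFieldType} (xs : seq R) (r : R) (k : nat) :
  0 < r -> (forall j, (j < k)%N -> elemsym xs j <= r * elemsym xs j.+1) ->
  r^-1 ^+ k <= elemsym xs k.
Proof.
move=> r0; elim: k => [|k IH] hr; first by rewrite elemsym0 expr0.
have {}IH := IH (fun j hj => hr j (ltnW hj)).
by rewrite exprS mulrC ler_pdivrMr // mulrC (le_trans IH) // hr.
Qed.

(** * Counting integers coprime to a product of primes *)

Definition ncoprime (l X : nat) : nat := \sum_(1 <= n < X.+1) coprime n l.

Lemma ncoprimeS (l X : nat) :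
  ncoprime l X.+1 = (ncoprime l X + coprime X.+1 l)%N.
Proof. by rewrite /ncoprime big_nat_recr. Qed.

(** Legendre's recursion: the integers coprime to l but not to p l are the
    multiples p m with m coprime to l. *)
Lemma ncoprime_mulp (p l X : nat) : prime p -> coprime p l ->
  (ncoprime (p * l) X + ncoprime l (X %/ p) = ncoprime l X)%N.
Proof.
move=> pp cpl; have p0 := prime_gt0 pp.
elim: X => [|X IH]; first by rewrite div0n /ncoprime !big_geq.
rewrite divnS // !ncoprimeS -IH coprimeMr (coprime_sym _ p) prime_coprime //.
case: (boolP (p %| X.+1)%N) => [/dvdnP[m e]|_]; last by rewrite /= add0n; lia.
have -> : (X %/ p = m.-1)%N.
  by have := divnS X p0; rewrite e mulnK // dvdn_mull //; lia.
have m0 : (0 < m)%N by move: e; case: m.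
rewrite /= add1n ncoprimeS prednK // e coprimeMl cpl andbT; lia.
Qed.

Definition invs (R : realFieldType) (P : seq nat) : seq R :=
  [seq (p%:R : R)^-1 | p <- P].

Lemma invs_ge0 (R : realFieldType) (P : seq nat) :
  all (fun x => 0 <= x) (invs R P).
Proof. by apply/allP => _ /mapP[p _ ->]; rewrite invr_ge0. Qed.

Lemma ncoprime1 : ncoprime 1 =1 id.
Proof.
move=> X; rewrite /ncoprime (eq_bigr (fun _ => 1%N)) => [|n _].
  by rewrite sum_nat_const_nat muln1 subn1.
by rewrite coprimen1.
Qed.

Lemma coprime_prodr (p : nat) (P : seq nat) :
  coprime p (\prod_(r <- P) r)%N = all (coprime p) P.
Proof.
elim: P => [|r P IH]; first by rewrite big_nil coprimen1.
by rewrite big_cons coprimeMr IH.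
Qed.

Lemma coprime_prod_primes (p : nat) (P : seq nat) :
  prime p -> all prime P -> p \notin P -> coprime p (\prod_(r <- P) r)%N.
Proof.
move=> pp Pp pP; rewrite coprime_prodr; apply/allP => r rP.
rewrite prime_coprime // dvdn_prime2 ?(allP Pp r rP) //.
by apply: contraNneq pP => ->.
Qed.

(** Here X is the number of positive integers below x. Legendre's recursion
    on P preserves the hypothesis x <= y ^ k, since removing a prime p >= y
    divides x by p and lowers k by one; it ends either with no positive integer
    below x <= 1, or with a single rounding error at most 1. The number of these
    errors is the number of products of fewer than k primes of P, and Y / p >= 1
    turns this number into the weighted sum on the right. *)
Lemma ncoprime_altsum (R : realFieldType) (y Y x : R) (P : seq nat) (k X : nat) :
  0 < y -> uniq P -> all prime P -> all (fun p => y <= p%:R <= Y) P ->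
  X%:R < x <= X.+1%:R -> x <= y ^+ k ->
  `|(ncoprime (\prod_(p <- P) p) X)%:R - x * altsum (invs R P) k| <=
    \sum_(0 <= j < k) Y ^+ j * elemsym (invs R P) j.
Proof.
move=> y0; elim: P k x X => [|p P IH] k x X.
  move=> _ _ _ /andP[x1 x2]; rewrite big_nil ncoprime1.
  case: k => [|k].
    rewrite expr0 => xle1; have : X%:R < 1%:R :> R by lra.
    rewrite ltr_nat ltnS leqn0 => /eqP ->.
    by rewrite /altsum !big_geq // mulr0 subr0 normr0.
  move=> _; rewrite /altsum !big_nat_recl //= !big1 => [|i _|i _]; rewrite ?mulr0 //.
  rewrite !expr0 !addr0 !mulr1 ler_norml; move: x2; rewrite -natr1; lra.
rewrite cons_uniq => /andP[pP uP] /andP[pp Pp] /andP[/andP[yp pY] PY].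
have p0 : 0 < p%:R :> R by rewrite ltr0n prime_gt0.
have cp := coprime_prod_primes _ _ pp Pp pP.
move=> /andP[x1 x2].
case: k => [|k].
  rewrite expr0 => xle1; have : X%:R < 1%:R :> R by lra.
  rewrite ltr_nat ltnS leqn0 => /eqP ->.
  by rewrite /altsum /ncoprime !big_geq // mulr0 subr0 normr0.
move=> xy.
rewrite big_cons /= altsum_cons.
have -> : (ncoprime (p * \prod_(j <- P) j) X)%:R =
  (ncoprime (\prod_(j <- P) j) X)%:R -
  (ncoprime (\prod_(j <- P) j) (X %/ p))%:R :> R.
  by rewrite -(ncoprime_mulp _ _ X pp cp) natrD addrK.
have h1 := IH k.+1 x X uP Pp PY (introT andP (conj x1 x2)) xy.
have h2 : `|(ncoprime (\prod_(j <- P) j) (X %/ p))%:R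
            - x / p%:R * altsum (invs R P) k| <=
    \sum_(0 <= j < k) Y ^+ j * elemsym (invs R P) j.
  apply: IH => //.
    have := leq_trunc_div X p; have := ltn_ceil X (prime_gt0 pp).
    rewrite -(ler_nat R) !natrM -(ler_nat R) natrM => h3 h4.
    by rewrite ltr_pdivlMr // ler_pdivrMr // (le_lt_trans h4) // (le_trans x2).
  rewrite ler_pdivrMr // (le_trans xy) // exprSr ler_wpM2l // exprn_ge0 //; lra.
set S1 := \sum_(0 <= j < k.+1) _ in h1; set S2 := \sum_(0 <= j < k) _ in h2.
suff hS : S1 + S2 <= \sum_(0 <= j < k.+1) Y ^+ j * elemsym (p%:R^-1 :: invs R P) j.
  apply: le_trans hS; apply: le_trans (lerD h1 h2).
  apply: le_trans (ler_normB _ _); rewrite le_eqVlt; apply/orP; left.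
  apply/eqP; congr `|_|; ring.
rewrite /S1 /S2 big_nat_recl // [leRHS]big_nat_recl // elemsym0 /= -addrA.
rewrite lerD2l -big_split /= ler_sum_nat // => j _.
rewrite mulrDr lerD2l exprS mulrACA ler_peMl //.
  rewrite mulr_ge0 ?elemsym_ge0 ?invs_ge0 // exprn_ge0 //; lra.
by rewrite ler_pdivlMr // mul1r.
Qed.

(** The truncated sieve misses the terms of rank k and above, which have the
    sign (-1)^k and size at least e_k / 2. The hypothesis on [Y ^ k] makes the
    rounding errors at most half of this. *)
Lemma sieve_deviation (R : realFieldType) (y Y s : R) (P : seq nat) (k X : nat) :
  1 <= y -> uniq P -> all prime P -> all (fun p => y <= p%:R <= Y) P ->
  (0 < k)%N -> s = \sum_(p <- P) (p%:R)^-1 ->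
  0 < s -> 2 * s <= k.+1%:R -> 2 * k%:R / s <= y ->
  16 * k%:R / s * Y ^+ k <= Y * y ^+ k ->
  X%:R < y ^+ k <= X.+1%:R ->
  y ^+ k * (4^-1 * (s / (2 * k%:R)) ^+ k) <=
   (-1) ^+ k * (y ^+ k * (\prod_(p <- P) (1 - (p%:R)^-1)) -
      (ncoprime (\prod_(p <- P) p) X)%:R).
Proof.
move=> y1 uP Pp PY k0 sE s0 sk ks kY hX.
have kR : 0 < k%:R :> R by rewrite ltr0n.
have y0 : 0 < y by lra.
have yk : 0 < y ^+ k by rewrite exprn_gt0.
have yY : y <= Y.
  case: (P) sE PY => [|p P' _ /= /andP[/andP[a b] _]]; last by lra.
  by rewrite big_nil => s00; lra.
have hx := ncoprime_altsum R y Y (y ^+ k) P k X y0 uP Pp PY hX (lexx _).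
have x0 := invs_ge0 R P.
have sE' : \sum_(x <- invs R P) x = s by rewrite big_map sE.
have xm : all (fun x => 0 <= x <= y^-1) (invs R P).
  apply/allP => _ /mapP[p pP ->]; rewrite invr_ge0 ler0n /=.
  by have /andP[? _] := allP PY p pP; rewrite lef_pV2 // posrE; lra.
have x01 : all (fun x => 0 <= x <= 1) (invs R P).
  apply: sub_all xm => x /andP[-> h] /=; apply: le_trans h _.
  by rewrite invf_le1.
set r := 2 * k%:R / s.
have r0 : 0 < r by rewrite /r divr_gt0 // mulr_gt0.
(* For ranks j < k, dropping the used primes costs at most half of s. *)
have rat j : (j < k)%N -> elemsym (invs R P) j <= r * elemsym (invs R P) j.+1.
  move=> jk; have := elemsym_ge _ _ j xm; rewrite sE' => h.
  have e0 := elemsym_ge0 _ j x0; have e1 := elemsym_ge0 _ j.+1 x0.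
  have jk1 : j.+1%:R <= k%:R :> R by rewrite ler_nat.
  have jk2 : j%:R <= k%:R :> R by rewrite ler_nat ltnW.
  have h1 : j%:R / y <= s / 2.
    rewrite ler_pdivrMr //; move: ks; rewrite ler_pdivrMr //; lra.
  rewrite /r mulrAC ler_pdivlMr //.
  have := ler_wpM2r e0 h1; have := ler_wpM2r e1 jk1; lra.
have gap := bonferroni_gap _ k x01.
have ek := elemsym_le _ k x0; rewrite sE' in ek.
have half : elemsym (invs R P) k.+1 <= elemsym (invs R P) k / 2.
  have e0 := elemsym_ge0 _ k x0.
  have k1 : 0 < k.+1%:R :> R by rewrite ltr0n.
  rewrite -(ler_pM2l k1); apply: le_trans ek _.
  by have := ler_wpM2r e0 sk; lra.
have r2Y : 2 * r <= Y.
  suff : 8 * r * y ^+ k <= Y * y ^+ k by rewrite ler_pM2r //; lra.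
  apply: le_trans kY; rewrite /r.
  have -> : 8 * (2 * k%:R / s) = 16 * k%:R / s by field; lra.
  by rewrite ler_wpM2l ?lerXn2r ?nnegrE //; [rewrite divr_ge0 //; lra|lra|lra].
have dsum := elemsym_ratio_sum _ Y r k x0 r0 r2Y rat.
have low := elemsym_ratio_ge _ r k r0 rat.
have -> : s / (2 * k%:R) = r^-1 by rewrite /r invf_div.
set D := \sum_(0 <= j < k) _ in hx dsum.
have D4 : D <= y ^+ k * elemsym (invs R P) k / 4.
  have Y0 : 0 < Y by lra.
  rewrite -(ler_pM2l Y0); apply: le_trans dsum _.
  have := ler_wpM2r (elemsym_ge0 _ k x0) kY.
  have -> : 16 * k%:R / s = 8 * r by rewrite /r; field; lra.
  lra.
have prodE : \prod_(x <- invs R P) (1 - x) = \prod_(p <- P) (1 - (p%:R)^-1).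
  by rewrite big_map.
rewrite prodE in gap.
move: gap hx low half D4; set T := altsum _ _; set N := _%:R; set e := elemsym _ k.
set Pi := \prod_(_ <- _) _ => gap hx low half D4.
have hx' : - D <= (-1) ^+ k * (y ^+ k * T - N).
  move: hx; rewrite ler_norml => /andP[].
  by rewrite -signr_odd; case: (odd k); rewrite ?expr1 ?expr0; lra.
have -> : (-1) ^+ k * (y ^+ k * Pi - N) =
   y ^+ k * ((-1) ^+ k * (Pi - T)) + (-1) ^+ k * (y ^+ k * T - N) by ring.
have g2 : e / 2 <= (-1) ^+ k * (Pi - T) by lra.
have := ler_wpM2l (ltW yk) g2; have := ler_wpM2l (ltW yk) low; lra.
Qed.

(** * Products of distinct primes *)

(** Powers of distinct primes are pairwise coprime. *)
Lemma prod_primepow_dvdn (P : seq nat) (e : nat -> nat) (n : nat) :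
  uniq P -> all prime P -> all (fun p => p ^ e p %| n)%N P ->
  (\prod_(p <- P) p ^ e p %| n)%N.
Proof.
elim: P => [|p P IH]; first by rewrite big_nil dvd1n.
rewrite cons_uniq => /andP[pP uP] /andP[pp Pp] /andP[pn Pn].
rewrite big_cons Gauss_dvd ?pn ?IH //.
have := coprime_prod_primes _ _ pp Pp pP; rewrite coprime_prodr => /allP h.
rewrite coprimeXl // big_seq; elim/big_ind: _ => [|a b ca cb|r rP].
- exact: coprimen1.
- by rewrite coprimeMr ca.
- by rewrite coprimeXr // h.
Qed.

Lemma prod_primes_dvdn (P : seq nat) (n : nat) :
  uniq P -> all prime P -> all (fun p => p %| n)%N P ->
  (\prod_(p <- P) p %| n)%N.
Proof.
move=> uP Pp Pn; have := prod_primepow_dvdn P (fun=> 1%N) n uP Pp Pn.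
by congr (_ %| _)%N; apply: eq_bigr => p _; rewrite expn1.
Qed.

Lemma ln_prod_seq (R : realType) (P : seq nat) (F : nat -> R) :
  (forall p, p \in P -> 0 < F p) ->
  ln (\prod_(p <- P) F p) = \sum_(p <- P) ln (F p).
Proof.
elim: P => [|p P IH] h; first by rewrite !big_nil ln1.
rewrite !big_cons lnM ?posrE ?h ?mem_head //; last first.
  by rewrite big_seq prodr_gt0 // => r rP; rewrite h // inE rP orbT.
by rewrite IH // => r rP; rewrite h // inE rP orbT.
Qed.

Lemma fact_le_expn (n : nat) : (n`! <= n ^ n)%N.
Proof.
elim: n => [|n IH] //; rewrite factS expnS leq_mul2l (leq_trans IH) ?orbT //.
by case: n {IH} => // n; rewrite leq_exp2r.
Qed.

(** The exponent of p in n! is at least the integer part of n / p, which is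
    at least n / 2p when p <= n. Hence n / 2 times the sum is at most
    ln n! <= n ln n. This is Mertens' estimate up to a factor 2. *)
Lemma sum_lnp_div_le_nat (R : realType) (P : seq nat) (n : nat) :
  uniq P -> all prime P -> all (fun p => p <= n)%N P -> (0 < n)%N ->
  \sum_(p <- P) ln (p%:R : R) / p%:R <= 2 * ln n%:R.
Proof.
move=> uP Pp Pn n0.
have nR : 0 < n%:R :> R by rewrite ltr0n.
have pR p : p \in P -> 1 <= p%:R :> R.
  by move=> pP; rewrite ler1n prime_gt0 // (allP Pp).
have dv : (\prod_(p <- P) p ^ (n %/ p) %| n`!)%N.
  apply: prod_primepow_dvdn => //; apply/allP => p pP.
  rewrite pfactor_dvdn ?fact_gt0 ?(allP Pp) // logn_fact ?(allP Pp) //.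
  by rewrite big_ltn // expn1 leq_addr.
have le1 : (\prod_(p <- P) p ^ (n %/ p) <= n ^ n)%N.
  by apply: leq_trans (fact_le_expn n); apply: dvdn_leq dv; rewrite fact_gt0.
have le2 : \sum_(p <- P) (n %/ p)%:R * ln (p%:R : R) <= n%:R * ln n%:R.
  move: le1; rewrite -(ler_nat R) natr_prod natrX => le1.
  have pos p : p \in P -> 0 < (p ^ (n %/ p))%:R :> R.
    by move=> pP; rewrite ltr0n expn_gt0 prime_gt0 // (allP Pp).
  have -> : \sum_(p <- P) (n %/ p)%:R * ln (p%:R : R) =
     ln (\prod_(p <- P) (p ^ (n %/ p))%:R).
    rewrite ln_prod_seq // big_seq [RHS]big_seq; apply: eq_bigr => p pP.
    by rewrite natrX lnXn ?mulr_natl // (lt_le_trans ltr01) ?pR.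
  rewrite mulr_natl -lnXn // ler_ln ?posrE ?exprn_gt0 //.
  by rewrite big_seq prodr_gt0.
rewrite -(ler_pM2l nR) mulr_sumr.
apply: (@le_trans _ _ (2 * \sum_(p <- P) (n %/ p)%:R * ln (p%:R : R))); last by lra.
rewrite mulr_sumr big_seq [leRHS]big_seq; apply: ler_sum => p pP.
have p1 := pR p pP; have lnp : 0 <= ln (p%:R : R) by rewrite ln_ge0.
rewrite mulrA [n%:R * _]mulrC -mulrA [leLHS]mulrC mulrC.
have h : n%:R / p%:R <= 2 * (n %/ p)%:R :> R.
  rewrite ler_pdivrMr; last by lra.
  rewrite -!natrM ler_nat; have := ltn_ceil n (prime_gt0 (allP Pp p pP)).
  have : (0 < n %/ p)%N by rewrite divn_gt0 ?prime_gt0 ?(allP Pp) // (allP Pn).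
  nia.
have := ler_wpM2r lnp h; lra.
Qed.

Lemma sum_lnp_div_le (R : realType) (P : seq nat) (w : R) :
  uniq P -> all prime P -> all (fun p => p%:R <= w) P -> 1 <= w ->
  \sum_(p <- P) ln (p%:R : R) / p%:R <= 2 * ln w.
Proof.
move=> uP Pp Pw w1; have w0 : 0 <= w by lra.
have t0 : (0 < Num.trunc w)%N by rewrite truncn_gt0.
apply: le_trans (sum_lnp_div_le_nat R P (Num.trunc w) uP Pp _ t0) _.
  by apply: sub_all Pw => p; rewrite truncn_ge_nat.
by rewrite ler_pM2l // ler_ln ?posrE ?ltr0n ?truncn_le //; lra.
Qed.

Lemma totient_prod_primes (R : realType) (P : seq nat) :
  uniq P -> all prime P ->
  (totient (\prod_(p <- P) p)%N)%:R / (\prod_(p <- P) p)%N%:R =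
   \prod_(p <- P) (1 - (p%:R)^-1) :> R.
Proof.
elim: P => [|p P IH]; first by rewrite !big_nil divr1.
rewrite cons_uniq => /andP[pP uP] /andP[pp Pp].
have p0 : p%:R != 0 :> R by rewrite pnatr_eq0 -lt0n prime_gt0.
rewrite !big_cons totient_coprime ?coprime_prod_primes // totient_prime //.
rewrite !natrM -IH // -subn1 natrB ?prime_gt0 // invfM mulrACA; congr (_ * _).
by rewrite mulrBl divff // mul1r.
Qed.

(** As l is invertible mod m, t |-> l t + n permutes the residues mod m. *)
Lemma sum_coprime_ap (l m n : nat) : coprime l m -> (0 < m)%N ->
  (\sum_(t < m) coprime (l * t + n) m)%N = totient m.
Proof.
move=> clm m0; rewrite totient_count_coprime big_mkord.
pose f (t : 'I_m) : 'I_m := Ordinal (ltn_pmod (l * t + n) m0).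
have finj : injective f.
  move=> a b [] /eqP; rewrite eqn_modDr => h; apply/val_inj => /=.
  have {h} : (l * a == l * b %[mod m])%N by [].
  wlog ab : a b / (a <= b)%N.
    move=> W h; case: (leqP a b) => ab; first exact: W.
    by symmetry; apply: (W b a (ltnW ab)); apply/eqP/esym/eqP.
  have lab : (l * a <= l * b)%N by rewrite leq_mul2l ab orbT.
  move=> /eqP/esym/eqP; rewrite (eqn_mod_dvd m lab).
  rewrite -mulnBr Gauss_dvdr; last by rewrite coprime_sym.
  move=> h; have bm : (b - a < m)%N.
    by apply: leq_ltn_trans (ltn_ord b); exact: leq_subr.
  apply/eqP; rewrite eqn_leq ab -subn_eq0 /=.
  by move: h; rewrite /dvdn modn_small.
rewrite [RHS](reindex_inj finj) /=; apply: eq_bigr => t _.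
by rewrite coprime_sym -coprime_modr.
Qed.

(** For n and the shift l t, coprimality to l depends on n only, while
    coprimality to m holds for phi(m) of the m values of t. *)
Lemma sum_coprime_shift (l m X : nat) : coprime l m -> (0 < m)%N ->
  (\sum_(t < m) \sum_(1 <= n < X.+1) coprime (l * t + n) (l * m))%N =
  (ncoprime l X * totient m)%N.
Proof.
move=> clm m0; rewrite exchange_big /ncoprime big_distrl /=.
apply: eq_bigr => n _.
rewrite -(sum_coprime_ap l m n clm m0) big_distrr /=; apply: eq_bigr => t _.
rewrite coprimeMr mulnb; congr (nat_of_bool (_ && _)).
by rewrite coprime_sym (coprime_sym n) mulnC /coprime gcdnMDl.
Qed.

Lemma exists_le_avg (m : nat) (F : 'I_m -> nat) (a : nat) : (0 < m)%N ->
  (\sum_(t < m) F t = a)%N -> exists t, (m * F t <= a)%N.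
Proof.
move=> m0 <-; apply/existsP; apply: contraT => /existsPn h.
pose t0 := Ordinal m0.
have : (\sum_(t < m) \sum_(t' < m) F t' < \sum_(t < m) m * F t)%N.
  rewrite (bigD1 t0) //= [X in (_ < X)%N](bigD1 t0) //= -addSn leq_add //.
    by rewrite ltnNge h.
  by apply: leq_sum => t _; rewrite ltnW // ltnNge h.
by rewrite sum_nat_const card_ord -big_distrr /= ltnn.
Qed.

Lemma exists_ge_avg (m : nat) (F : 'I_m -> nat) (a : nat) : (0 < m)%N ->
  (\sum_(t < m) F t = a)%N -> exists t, (a <= m * F t)%N.
Proof.
move=> m0 <-; apply/existsP; apply: contraT => /existsPn h.
pose t0 := Ordinal m0.
have : (\sum_(t < m) m * F t < \sum_(t < m) \sum_(t' < m) F t')%N.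
  rewrite (bigD1 t0) //= [X in (_ < X)%N](bigD1 t0) //= -addSn leq_add //.
    by rewrite ltnNge h.
  by apply: leq_sum => t _; rewrite ltnW // ltnNge h.
by rewrite sum_nat_const card_ord -big_distrr /= ltnn.
Qed.

(** On an open interval starting at the integer a the integers are the a + n
    with 1 <= n < x, which is what the choice of X says. *)
Lemma coprime_count_itv (R : realType) (q a X : nat) (x : R) :
  X%:R < x <= X.+1%:R ->
  coprime_count q (`]a%:R, (a%:R + x)[ : interval R) =
  (\sum_(1 <= n < X.+1) coprime (a + n) q)%N%:R.
Proof.
move=> /andP[x1 x2]; rewrite /coprime_count.
pose r := [seq (a + n)%N%:Z | n <- index_iota 1 X.+1 & coprime (a + n) q].
have ur : uniq r.
  rewrite map_inj_uniq ?filter_uniq ?iota_uniq // => i j /eqP.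
  by rewrite eqz_nat eqn_add2l => /eqP.
have -> : [set n : int | (n%:~R \in (`]a%:R, (a%:R + x)[ : interval R))
                         /\ coprimez n q%:Z] = [set` r].
  apply/seteqP; split => n /=.
    rewrite in_itv /= => -[/andP[n1 n2] nq].
    case: n n1 n2 nq => n; last first.
      rewrite NegzE mulrNz -pmulrn => n1 _ _; exfalso.
      have : 0 <= a%:R :> R by []. have : 0 <= n.+1%:R :> R by [].
      lra.
    rewrite -pmulrn ltr_nat => n1 n2 nq; apply/mapP; exists (n - a)%N.
      rewrite mem_filter subnKC 1?ltnW // mem_index_iota subn_gt0 n1 /=.
      rewrite andbC; apply/andP; split; last exact: nq.
      have : n%:R < (a + X.+1)%N%:R :> R by rewrite natrD; lra.
      rewrite ltr_nat; lia.
    by rewrite subnKC // ltnW.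
  move=> /mapP[k]; rewrite mem_filter mem_index_iota => /andP[ck /andP[k1 k2]] ->.
  split; last exact: ck.
  rewrite in_itv /= -pmulrn natrD ltrDl ltr0n k1 /= ltrD2l.
  by apply: le_lt_trans x1; rewrite ler_nat -ltnS.
rewrite -fsbig_seq // /r big_map big_filter natr_sum big_mkcond /=.
by apply: eq_bigr => n _; case: coprime.
Qed.

Lemma itv_length_oo (R : realType) (a x : R) : 0 < x ->
  itv_length `]a, (a + x)[ = x%:E.
Proof.
move=> x0; rewrite /itv_length lebesgue_measure_itv /= lte_fin ltrDl x0.
by rewrite -EFinD addrC addKr.
Qed.

Lemma squarefree_coprime_div (q l : nat) : (0 < q)%N -> squarefree q ->
  (l %| q)%N -> coprime l (q %/ l).
Proof.
move=> q0 sq lq; apply/eqP/(sq (gcdn l (q %/ l))).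
by rewrite -[X in (_ %| X)%N](divnK lq) mulnC -mulnn dvdn_mul ?dvdn_gcdl ?dvdn_gcdr.
Qed.

(** The deviation for the product l of P passes to q: some shift of the
    interval by a multiple of l does at least as well, in the direction given by
    the parity of k, as the average over these shifts. *)
Lemma interval_deviation (R : realType) (q : nat) (y Y s : R)
    (P : seq nat) (k : nat) :
  squarefree q -> (0 < q)%N ->
  1 <= y -> uniq P -> all prime P -> all (fun p => p %| q)%N P ->
  all (fun p => y <= p%:R <= Y) P ->
  (0 < k)%N -> s = \sum_(p <- P) (p%:R)^-1 ->
  0 < s -> 2 * s <= k.+1%:R -> 2 * k%:R / s <= y ->
  16 * k%:R / s * Y ^+ k <= Y * y ^+ k ->
  exists I : interval R, itv_length I = (y ^+ k)%:E /\
   (totient q)%:R / q%:R * (4^-1 * (s / (2 * k%:R)) ^+ k) * y ^+ k <=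
    (-1) ^+ k * ((totient q)%:R / q%:R * y ^+ k - coprime_count q I).
Proof.
move=> sq q0 y1 uP Pp Pq PY k0 sE s0 sk ks kY.
set l := (\prod_(p <- P) p)%N; set m := (q %/ l)%N.
have lq : (l %| q)%N by exact: prod_primes_dvdn.
have clm : coprime l m by exact: squarefree_coprime_div.
have qE : (l * m = q)%N by rewrite mulnC divnK.
have l0 : (0 < l)%N by move: q0; rewrite -qE muln_gt0 => /andP[].
have m0 : (0 < m)%N by move: q0; rewrite -qE muln_gt0 => /andP[].
have x0 : 0 < y ^+ k by rewrite exprn_gt0 //; lra.
(* X = ceil (y ^ k) - 1. *)
have [X hX] : exists X : nat, X%:R < y ^+ k <= X.+1%:R.
  have [n hn] : exists n : nat, y ^+ k <= n%:R.
    by exists (Num.trunc (y ^+ k)).+1; rewrite ltW // truncnS_gt.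
  have hex : exists n : nat, y ^+ k <= n%:R by exists n.
  case: (ex_minnP hex) => -[|X] h1 h2.
    by move: h1; rewrite leNgt x0.
  by exists X; rewrite h1 andbT ltNge; apply/negP => /h2; rewrite ltnn.
have := sieve_deviation R y Y s P k X y1 uP Pp PY k0 sE s0 sk ks kY hX.
rewrite -(totient_prod_primes R P uP Pp) -/l.
set th := (4^-1 * _) => dev.
have mR : 0 < m%:R :> R by rewrite ltr0n.
have lR : 0 < l%:R :> R by rewrite ltr0n.
have fE : (totient q)%:R / q%:R = (totient m)%:R / m%:R * ((totient l)%:R / l%:R) :> R.
  by rewrite -qE totient_coprime // !natrM; field; lra.
have fl1 : (totient l)%:R / l%:R <= 1 :> R.
  rewrite ler_pdivrMr // mul1r ler_nat totient_count_coprime.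
  apply: leq_trans (_ : \sum_(0 <= d < l) 1 <= l)%N; last first.
    by rewrite sum_nat_const_nat subn0 muln1.
  by apply: leq_sum => i _; case: coprime.
have fm0 : 0 <= (totient m)%:R / m%:R :> R by rewrite divr_ge0.
have th0 : 0 <= th.
  rewrite /th mulr_ge0 // ?invr_ge0 // exprn_ge0 // divr_ge0 ?mulr_ge0 //; lra.
(* A shift on the side of the average prescribed by the parity of k is enough. *)
suff [t ht] : exists t : 'I_m,
    (-1) ^+ k * (\sum_(1 <= n < X.+1) coprime (l * t + n) q)%N%:R <=
    (-1) ^+ k * ((totient m)%:R / m%:R * (ncoprime l X)%:R) :> R.
  exists `](l * t)%N%:R, ((l * t)%N%:R + y ^+ k)[; split; first exact: itv_length_oo.
  rewrite (coprime_count_itv R q (l * t) X (y ^+ k) hX) mulrBr.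
  have := ler_wpM2l fm0 dev.
  have : (totient q)%:R / q%:R * th * y ^+ k <= (totient m)%:R / m%:R * (y ^+ k * th) :> R.
    have h0 := mulr_ge0 fm0 (mulr_ge0 (ltW x0) th0).
    by rewrite fE; have := ler_wpM2r h0 fl1; lra.
  rewrite fE; lra.
have av := sum_coprime_shift l m X clm m0; rewrite qE in av.
have [t ht] := exists_le_avg _ _ _ m0 av; have [t' ht'] := exists_ge_avg _ _ _ m0 av.
rewrite -signr_odd; case: (odd k); [exists t'|exists t].
  rewrite expr1 !mulN1r lerN2 mulrAC ler_pdivrMr //.
  by rewrite -!natrM ler_nat mulnC [X in (_ <= X)%N]mulnC.
rewrite expr0 !mul1r mulrAC ler_pdivlMr //.
by rewrite -!natrM ler_nat mulnC [X in (_ <= X)%N]mulnC.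
Qed.

(** * Prime factors of q in a short range *)

Lemma ln2_ge (R : realType) : 1 <= 2 * ln (2 : R).
Proof.
have h : -1 < - 2^-1 :> R by lra.
have := le_ln1Dx h; have -> : 1 + - 2^-1 = 2^-1 :> R by lra.
by rewrite lnV ?posrE //; lra.
Qed.

Lemma size_primes_le (R : realType) (q : nat) : (0 < q)%N ->
  (size (primes q))%:R <= 2 * ln (q%:R : R).
Proof.
move=> q0.
have h : (2 ^ size (primes q) <= q)%N.
  apply: (@leq_trans (\prod_(p <- primes q) p)%N); last first.
    apply: dvdn_leq => //; apply: prod_primes_dvdn; rewrite ?primes_uniq //.
      exact: all_prime_primes.
    by apply/allP => p; rewrite mem_primes => /and3P[].
  have := all_prime_primes q; elim: (primes q) => [|p P IH]; first by rewrite big_nil.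
  by move=> /= /andP[pp Pp]; rewrite big_cons expnS leq_mul ?IH ?prime_gt1.
have : ln ((2 ^ size (primes q))%N%:R : R) <= ln q%:R.
  by rewrite ler_ln ?posrE ?ltr0n ?expn_gt0 // ler_nat.
rewrite natrX lnXn // -[ln _ *+ _]mulr_natr.
have := ler_wpM2r (ler0n R (size (primes q))) (ln2_ge R); lra.
Qed.

(** With t = ln p, one has t <= 2 expR (t / 2), so that
    ln p / p <= 2 expR (- t / 2). *)
Lemma lnp_div_le (R : realType) (p : nat) (L : R) :
  (0 < p)%N -> 2 * L <= ln (p%:R : R) -> ln (p%:R : R) / p%:R <= 2 / expR L.
Proof.
move=> p0; set t := ln _ => Lt.
have pR : 0 < p%:R :> R by rewrite ltr0n.
have -> : p%:R = expR (t / 2) * expR (t / 2) :> R.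
  by rewrite -expRD -[LHS]lnK ?posrE //; congr expR; rewrite -/t; lra.
have e0 := expR_gt0 (t / 2); have eL := expR_gt0 L.
rewrite ler_pdivrMr ?mulr_gt0 // mulrAC ler_pdivlMr //.
have h1 : t <= 2 * expR (t / 2) by have := expR_ge1Dx (t / 2); lra.
have h2 : expR L <= expR (t / 2) by rewrite ler_expR; lra.
have := ler_wpM2r (ltW eL) h1.
have := ler_wpM2l (mulr_ge0 (ler0n R 2) (ltW e0)) h2; lra.
Qed.

(** Beyond (ln q)^2 each term is at most 2 / ln q, and q has at most 2 ln q
    prime factors. *)
Lemma sum_large_le (R : realType) (q : nat) :
  let L := ln (ln (q%:R : R)) in 0 < ln (q%:R : R) ->
  \sum_(p <- primes q | 2 * L < ln p%:R) ln (p%:R : R) / p%:R <= 4.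
Proof.
move=> L lq; have q0 : (0 < q)%N.
  by case: q lq {L} => //; rewrite ln0 // ltxx.
apply: (@le_trans _ _ (\sum_(p <- primes q) 2 / ln (q%:R : R))).
  rewrite big_mkcond big_seq [leRHS]big_seq; apply: ler_sum => p.
  rewrite mem_primes => /and3P[/prime_gt0 p0 _ _].
  case: ifP => [h|_]; last by rewrite divr_ge0 ?ltW.
  by have := lnp_div_le R p L p0 (ltW h); rewrite /L lnK.
rewrite big_const_seq count_predT iter_addr_0 -[_ *+ size _]mulr_natr.
rewrite mulrAC ler_pdivrMr //.
have := size_primes_le R q q0; lra.
Qed.

Lemma natr_le_expR (R : realType) (p : nat) (t : R) : (0 < p)%N ->
  (p%:R <= expR t) = (ln p%:R <= t).
Proof.
by move=> p0; rewrite -[in RHS](expRK t) ler_ln ?posrE ?expR_gt0 ?ltr0n.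
Qed.

Lemma expR_le_natr (R : realType) (p : nat) (t : R) : (0 < p)%N ->
  (expR t <= p%:R) = (t <= ln p%:R).
Proof.
by move=> p0; rewrite -[in RHS](expRK t) ler_ln ?posrE ?expR_gt0 ?ltr0n.
Qed.

Lemma sum_lnp_primes_le (R : realType) (q : nat) (c : pred nat) (t : R) :
  0 <= t -> (forall p, p \in primes q -> c p -> ln p%:R <= t) ->
  \sum_(p <- primes q | c p) ln (p%:R : R) / p%:R <= 2 * t.
Proof.
move=> t0 ct; rewrite -big_filter -[in leRHS](expRK t).
apply: sum_lnp_div_le; rewrite ?filter_uniq ?primes_uniq //.
- by apply/allP => p; rewrite mem_filter mem_primes => /and4P[].
- apply/allP => p; rewrite mem_filter => /andP[cp pq].
  rewrite natr_le_expR ?ct //.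
  by move: pq; rewrite mem_primes => /and3P[/prime_gt0].
- by have := expR_ge1Dx t; lra.
Qed.

Lemma sum_lnp_primes_total (R : realType) (q : nat) :
  let L := ln (ln (q%:R : R)) in 0 < ln (q%:R : R) -> 0 <= L ->
  \sum_(p <- primes q) ln (p%:R : R) / p%:R <= 4 * L + 4.
Proof.
move=> L lq L0; have := sum_large_le R q lq; rewrite -/L => large.
have small := sum_lnp_primes_le R q (fun p => ln (p%:R : R) <= 2 * L) (2 * L)
  ltac:(lra) ltac:(by []).
rewrite (bigID (fun p => 2 * L < ln (p%:R : R))) /=.
under [X in _ + X <= _]eq_bigl do rewrite -leNgt.
lra.
Qed.

Lemma pigeonhole_sum (R : realType) (P : seq nat) (f : nat -> R)
    (b : nat -> nat) (J : nat) :
  (forall p, p \in P -> (b p <= J)%N) ->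
  exists j : nat, \sum_(p <- P) f p <= J.+1%:R * \sum_(p <- P | b p == j) f p.
Proof.
move=> bJ.
have -> : \sum_(p <- P) f p = \sum_(j < J.+1) \sum_(p <- P | b p == j) f p.
  rewrite (exchange_big_dep predT) //= big_seq [RHS]big_seq.
  apply: eq_bigr => p pP; rewrite (big_pred1 (inord (b p))) // => j /=.
  by rewrite -val_eqE /= inordK ?ltnS ?bJ // eq_sym.
have [j _ hj] := @Order.TotalTheory.arg_maxP _ R _ (ord0 : 'I_J.+1) predT
   (fun j => \sum_(p <- P | b p == j) f p) isT.
exists j; rewrite mulr_natl -[X in _ *+ X]card_ord -sumr_const.
by apply: ler_sum => i _; apply: hj.
Qed.

(** The primes with S / 8 < ln p <= 2 L carry at least half of S, so the sum
    of their inverses is at least S / 4L. They fall into O(L / eta) = O(u L / S)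
    blocks j eta <= ln p <= (j+1) eta, and the pigeonhole principle gives the
    heaviest one. Its mass is at most 4 by [sum_lnp_div_le], as ln p varies
    on it by a factor at most 2. *)
Lemma exists_block (R : realType) (q : nat) (u : R) :
  let L := ln (ln (q%:R : R)) in
  let S := \sum_(p <- primes q) ln (p%:R : R) / p%:R in
  let eta := S / (64 * u) in
  0 < ln (q%:R : R) -> 60 <= S -> 32 <= u -> 1 <= L -> 64 * (L / S) <= u ->
  exists (P : seq nat) (j : nat),
    [/\ uniq P, all prime P, all (fun p => p %| q)%N P,
       all (fun p => expR (j%:R * eta) <= p%:R <= expR (j.+1%:R * eta)) P &
     [/\ S / 16 <= j%:R * eta, u^-1 ^+ 3 <= \sum_(p <- P) (p%:R)^-1 &
       \sum_(p <- P) (p%:R)^-1 <= 4 :> R]].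
Proof.
move=> L S eta lq S60 u32 L1 rle.
have large := sum_large_le R q lq; rewrite -/L in large.
have total := sum_lnp_primes_total R q lq (le_trans ler01 L1).
rewrite -/L -/S in total.
have SE : S = \sum_(p <- primes q) ln (p%:R : R) / p%:R by [].
move: @eta S60 rle SE total; clearbody L S => eta S60 rle SE total.
have S0 : 0 < S by lra.
have u0 : 0 < u by lra.
have eta0 : 0 < eta by rewrite /eta divr_gt0 ?mulr_gt0.
have prP p : p \in primes q -> prime p by rewrite mem_primes => /and3P[].
have lnp0 p : prime p -> 0 <= ln (p%:R : R).
  by move=> pp; rewrite ln_ge0 // ler1n prime_gt0.
(* Discarding the small and the large primes leaves half of S. *)
pose mid p := (S / 8 < ln (p%:R : R)) && (ln (p%:R : R) <= 2 * L).
have midS : S / 2 <= \sum_(p <- primes q | mid p) ln (p%:R : R) / p%:R.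
  have small := sum_lnp_primes_le R q (fun p => ln (p%:R : R) <= S / 8)
    (S / 8) ltac:(lra) ltac:(by []).
  have : S <= \sum_(p <- primes q | mid p) ln (p%:R : R) / p%:R +
     \sum_(p <- primes q | ln p%:R <= S / 8) ln (p%:R : R) / p%:R +
     \sum_(p <- primes q | 2 * L < ln p%:R) ln (p%:R : R) / p%:R.
    rewrite [leLHS]SE [X in _ <= X + _ + _]big_mkcond [X in _ <= _ + X + _]big_mkcond.
    rewrite [X in _ <= _ + X]big_mkcond -!big_split big_seq [leRHS]big_seq.
    apply: ler_sum => p pq; rewrite /mid.
    have := lnp0 p (prP p pq).
    have : 0 <= ln (p%:R : R) / p%:R by rewrite divr_ge0 // lnp0 // prP.
    by case: (ltP (S / 8) (ln p%:R)); case: (leP (ln p%:R) (2 * L)) => /=; lra.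
  lra.
have S8L : S <= 8 * L by move: total; lra.
have midI : S / (4 * L) <= \sum_(p <- [seq p <- primes q | mid p]) (p%:R : R)^-1.
  rewrite ler_pdivrMr; last by lra.
  have : \sum_(p <- primes q | mid p) ln (p%:R : R) / p%:R <=
     2 * L * \sum_(p <- [seq p <- primes q | mid p]) (p%:R : R)^-1.
    rewrite big_filter mulr_sumr; apply: ler_sum => p /andP[_ h].
    by rewrite ler_wpM2r ?invr_ge0.
  lra.
(* The blocks are indexed by the integer part of ln p / eta. *)
pose b p := Num.trunc (ln (p%:R : R) / eta).
have [|j hj] := pigeonhole_sum R [seq p <- primes q | mid p]
   (fun p => (p%:R : R)^-1) b (Num.trunc (2 * L / eta)).
  move=> p; rewrite mem_filter => /andP[/andP[_ h] _].
  by apply: le_truncn; rewrite ler_pM2r ?invr_gt0.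
pose P := [seq p <- [seq p <- primes q | mid p] | b p == j].
rewrite -[X in _ * X]big_filter -/P in hj.
have PP p : p \in P -> [/\ prime p, (p %| q)%N, mid p & b p = j].
  rewrite !mem_filter mem_primes => /andP[/eqP -> /andP[-> /and3P[-> _ ->]]].
  by split.
have Pj p : p \in P -> j%:R * eta <= ln p%:R <= j.+1%:R * eta.
  move=> /PP[pp _ _ <-].
  have h0 : 0 <= ln (p%:R : R) / eta by rewrite divr_ge0 ?lnp0 ?ltW.
  by have /andP[h1 h2] := truncn_itv h0; rewrite -ler_pdivlMr // h1 -ler_pdivrMr // ltW.
have r0 : 0 < L / S by rewrite divr_gt0 //; lra.
have J129 : (Num.trunc (2 * L / eta)).+1%:R <= 129 * (L / S) * u.
  rewrite -natr1.
  have h0 : 0 <= 2 * L / eta by rewrite divr_ge0 ?ltW //; lra.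
  have : (Num.trunc (2 * L / eta))%:R <= 2 * L / eta by rewrite truncn_le.
  have -> : 2 * L / eta = 128 * (L / S) * u by rewrite /eta; field; lra.
  have h8 : 1 / 8 <= L / S by rewrite ler_pdivlMr //; lra.
  have := ler_wpM2r (ltW u0) h8; lra.
have s3 : u^-1 ^+ 3 <= \sum_(p <- P) (p%:R : R)^-1.
  set s := \sum_(p <- P) _ in hj *.
  have s0 : 0 <= s by rewrite sumr_ge0.
  have h1 : S / (4 * L) <= 129 * (L / S) * u * s.
    apply: le_trans midI _; apply: le_trans hj _; exact: ler_wpM2r.
  have h2 : 1 <= 516 * (L / S) ^+ 2 * u * s.
    have e1 : 4 * (L / S) * (S / (4 * L)) = 1 by field; lra.
    rewrite -[leLHS]e1.
    have := ler_wpM2l (mulr_ge0 (ler0n R 4) (ltW r0)) h1; lra.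
  have h3 : 516 * (L / S) ^+ 2 <= u ^+ 2.
    have : (64 * (L / S)) ^+ 2 <= u ^+ 2.
      by apply: lerXn2r; rewrite ?nnegrE //; lra.
    have := sqr_ge0 (L / S); lra.
  rewrite exprVn -div1r ler_pdivrMr ?exprn_gt0 //.
  have := ler_wpM2r (mulr_ge0 (ltW u0) s0) h3; lra.
have ex : exists2 p, p \in P & S / 8 < ln (p%:R : R).
  case E : P s3 => [|p P']; first by rewrite big_nil leNgt exprn_gt0 ?invr_gt0.
  move=> _; have := PP p; rewrite E mem_head => /(_ isT) [_ _ /andP[]].
  by exists p; rewrite ?mem_head.
have eta16 : eta <= S / 16 by rewrite /eta ler_pM2l // lef_pV2 ?posrE; lra.
(* The block contains a prime with ln p > S / 8, and is shorter than S / 16. *)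
have S16 : S / 16 <= j%:R * eta.
  have [p pP hp] := ex; have /andP[_] := Pj p pP; rewrite -natr1; lra.
exists P, j; split.
- by rewrite !filter_uniq ?primes_uniq.
- by apply/allP => p /PP[].
- by apply/allP => p /PP[].
- apply/allP => p pP; have [pp _ _ _] := PP p pP.
  by rewrite expR_le_natr ?natr_le_expR ?Pj // prime_gt0.
split => //.
have j1 : 0 < j%:R * eta by lra.
rewrite -(ler_pM2l j1).
apply: (@le_trans _ _ (\sum_(p <- P) ln (p%:R : R) / p%:R)).
  rewrite mulr_sumr big_seq [leRHS]big_seq; apply: ler_sum => p pP.
  by rewrite ler_wpM2r ?invr_ge0 //; have /andP[] := Pj p pP.
apply: (@le_trans _ _ (2 * ln (expR (j.+1%:R * eta)))).
  apply: sum_lnp_div_le.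
  - by rewrite !filter_uniq ?primes_uniq.
  - by apply/allP => p /PP[].
  - apply/allP => p pP; have [pp _ _ _] := PP p pP.
    by rewrite natr_le_expR ?prime_gt0 //; have /andP[] := Pj p pP.
  - have := expR_ge1Dx (j.+1%:R * eta); rewrite -natr1; lra.
rewrite expRK -natr1; lra.
Qed.

(** * Choice of the parameters *)

Lemma ln_zparam (R : realType) (c1 : R) (q : nat) :
  ln (zparam c1 q) = c1 * \sum_(p <- primes q) ln (p%:R : R) / p%:R.
Proof.
have pos p : p \in primes q -> 0 < p%:R `^ (p%:R)^-1 :> R.
  by rewrite mem_primes => /and3P[pp _ _]; rewrite powR_gt0 // ltr0n prime_gt0.
rewrite /zparam ln_powR ln_prod_seq //; congr (_ * _).
by apply: eq_bigr => p _; rewrite ln_powR mulrC.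
Qed.

Lemma exists_parity (R : realType) (u : R) (b : bool) : 8 <= u ->
  exists k : nat, [/\ odd k = b, u / 4 <= k%:R & k%:R <= u / 2].
Proof.
move=> u8; pose n := (Num.trunc (u / 4)).+1.
have h1 : u / 4 <= n%:R by rewrite ltW // truncnS_gt.
have h2 : n%:R <= u / 4 + 1.
  by rewrite -[n%:R]natr1 lerD2r truncn_le; lra.
have h3 : n.+1%:R = n%:R + 1 :> R by rewrite natr1.
clearbody n; have [nb|nb] := boolP (odd n == b).
  by exists n; split; [exact/eqP|exact: h1|lra].
exists n.+1; split; [|rewrite h3; lra..].
by move: nb => /=; case: b; case: (odd n).
Qed.

(** The bounds u <= k * 4 and y >= expR (S / 16) give the length
    y ^ k >= expR (u S / 64), and k eta <= S / 128 keeps Y ^ k within a small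
    power of y of y ^ k. *)
Lemma exists_deviating_interval (R : realType) (q : nat) (u : R) (b : bool) :
  let L := ln (ln (q%:R : R)) in
  let S := \sum_(p <- primes q) ln (p%:R : R) / p%:R in
  squarefree q -> 0 < ln (q%:R : R) -> 60 <= S -> 1 <= L ->
  32 <= u -> 64 * (L / S) <= u -> ln u <= S / 200 ->
  exists I : interval R, exists2 x : R, itv_length I = x%:E &
   expR (u * (S / 100)) <= x /\
   (totient q)%:R / q%:R * (u `^ (3 * u))^-1 * x <=
    (-1) ^+ b * ((totient q)%:R / q%:R * x - coprime_count q I).
Proof.
move=> L S sq lq S60 L1 u32 rle lnu.
have q0 : (0 < q)%N by case: q lq {L S sq S60 L1 rle lnu} => //; rewrite ln0 // ltxx.
have [P [j [uP Pp Pq PY [S16 s3 s4]]]] := exists_block R q u lq S60 u32 L1 rle.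
rewrite -/S in PY S16; set eta := S / (64 * u) in PY S16.
have u0 : 0 < u by lra.
have [k [kb ku1 ku2]] := exists_parity R u b ltac:(lra).
set y := expR (j%:R * eta) in PY; set Y := expR (j.+1%:R * eta) in PY.
move: s3 s4; set s := \sum_(p <- P) _ => s3 s4.
have uE : u = expR (ln u) by rewrite lnK.
have s0 : 0 < s by apply: lt_le_trans s3; rewrite exprn_gt0 ?invr_gt0.
have k0 : 0 < k%:R :> R by lra.
have k0' : (0 < k)%N by rewrite -(ltr0n R).
have S0 : 0 < S by lra.
have sinv : s^-1 <= u ^+ 3.
  rewrite -[u]invrK exprVn lef_pV2 ?posrE // exprn_gt0 ?invr_gt0 //.
have u5 : u ^+ 5 <= expR (S / 40).
  by rewrite {1}uE -expRM_natl ler_expR; lra.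
have u4_5 : 8 * u ^+ 4 <= u ^+ 5.
  by rewrite [leRHS]exprS ler_wpM2r ?exprn_ge0; lra.
have ks : 16 * k%:R / s <= u ^+ 5.
  apply: le_trans u4_5.
  have h1 := ler_wpM2l (mulr_ge0 (ler0n R 16) (ltW k0)) sinv.
  have h2 := ler_wpM2r (exprn_ge0 3 (ltW u0)) ku2; lra.
have yS : expR (S / 16) <= y by rewrite ler_expR.
have YE : Y = y * expR eta by rewrite /Y /y -natr1 -expRD; congr expR; ring.
have eta0 : 0 < eta by rewrite /eta divr_gt0 ?mulr_gt0.
have [I [IE Idev]] : exists I : interval R, itv_length I = (y ^+ k)%:E /\
   (totient q)%:R / q%:R * (4^-1 * (s / (2 * k%:R)) ^+ k) * y ^+ k <=
    (-1) ^+ k * ((totient q)%:R / q%:R * y ^+ k - coprime_count q I).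
  apply: (interval_deviation R q y Y s P k) => //.
  - by have := expR_ge1Dx (S / 16); lra.
  - by rewrite -natr1; lra.
  - have h0 : 0 <= k%:R / s by rewrite divr_ge0 // ltW.
    have : expR (S / 40) <= expR (S / 16) by rewrite ler_expR; lra.
    by move: ks; lra.
  - rewrite YE exprMn mulrA [leRHS]mulrC [leLHS]mulrAC [leLHS]mulrC.
    rewrite ler_wpM2l ?exprn_ge0 ?expR_ge0 //.
    rewrite -expRM_natl.
    apply: (@le_trans _ _ (expR (S / 40) * expR (k%:R * eta))).
      by rewrite ler_wpM2r ?expR_ge0 // (le_trans ks).
    apply: (@le_trans _ _ y); last first.
      by rewrite ler_peMr ?expR_ge0 //; have := expR_ge1Dx eta; lra.
    apply: le_trans yS; rewrite -expRD ler_expR.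
    have : k%:R * eta <= u / 2 * eta by rewrite ler_wpM2r // ltW.
    have -> : u / 2 * eta = S / 128 by rewrite /eta; field; lra.
    lra.
exists I; exists (y ^+ k) => //; split.
  rewrite -expRM_natl ler_expR.
  have h1 := ler_wpM2r (ltW (lt_le_trans (divr_gt0 S0 (ltr0n R 16)) S16)) ku1.
  have h2 := ler_wpM2l (ltW (divr_gt0 u0 (ltr0n R 4))) S16.
  have := mulr_gt0 u0 S0; lra.
have -> : (-1) ^+ b = (-1) ^+ k :> R by rewrite -kb signr_odd.
apply: le_trans Idev.
rewrite ler_wpM2r ?exprn_ge0 ?expR_ge0 // ler_wpM2l ?divr_ge0 //.
have lnu0 : 0 <= ln u by rewrite ln_ge0; lra.
have h1 : u^-1 ^+ 4 <= s / (2 * k%:R).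
  rewrite ler_pdivlMr ?mulr_gt0 // exprSr -mulrA.
  have : u^-1 * (2 * k%:R) <= 1 by rewrite mulrC ler_pdivrMr //; lra.
  move=> h; apply: le_trans s3; apply: ler_piMr => //.
  by rewrite exprn_ge0 // invr_ge0 ltW.
apply: (@le_trans _ _ (4^-1 * (u^-1 ^+ 4) ^+ k)); last first.
  rewrite ler_wpM2l ?invr_ge0 //; apply: lerXn2r => //; rewrite nnegrE.
    by rewrite exprn_ge0 // invr_ge0 ltW.
  by rewrite divr_ge0 ?mulr_ge0 // ltW.
rewrite {1}/powR gt_eqF // -expRN.
have -> : u^-1 = expR (- ln u) by rewrite expRN lnK.
rewrite -!expRM_natl.
have -> : 4^-1 = expR (- ln 4) :> R by rewrite expRN lnK ?posrE.
rewrite -expRD ler_expR.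
have ln4 : ln (4 : R) <= ln u by rewrite ler_ln ?posrE //; lra.
have h2 : k%:R * ln u <= u / 2 * ln u by rewrite ler_wpM2r.
have h3 : 1 * ln u <= u * ln u by rewrite ler_wpM2r //; lra.
lra.
Qed.

Theorem corollary1p2 (R : realType) :
  exists c1 c2 C : R, exists q0 : nat,
    [/\ 0 < c1, 0 < c2, 0 < C &
     forall q : nat, (q0 <= q)%N -> squarefree q ->
       60%:R * ln (ln (ln (q%:R : R))) <=
         \sum_(p <- primes q) ln (p%:R : R) / p%:R ->
       let z := zparam c1 q in
       forall u : R,
         u <= Num.sqrt z ->
         C * (ln (ln (q%:R : R)) / ln z) ^+ 3 <= u ->
         exists Ip Im : interval R,
           [/\ ((z `^ u)%:E <= itv_length Ip < +oo)%E,
               ((z `^ u)%:E <= itv_length Im < +oo)%E,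
               (1 + 1 / u `^ (c2 * u)) * ((totient q)%:R / q%:R)
                 * fine (itv_length Ip) <= coprime_count q Ip &
               coprime_count q Im <=
                 (1 - 1 / u `^ (c2 * u)) * ((totient q)%:R / q%:R)
                   * fine (itv_length Im)]].
Proof.
(* The threshold for q makes ln ln ln q at least 1, so that S >= 60. *)
exists (100^-1), 3, 1, (Num.trunc (expR (expR (expR (1 : R))))).+1.
split; rewrite ?invr_gt0 //.
move=> q qq0 sq hS z u uz uL.
have qbig : expR (expR (expR (1 : R))) <= q%:R.
  by apply: le_trans (ltW (truncnS_gt _)) _; rewrite ler_nat.
have lnge (s t : R) : expR s <= t -> s <= ln t.
  move=> h; rewrite -[leLHS]expRK ler_ln ?posrE ?expR_gt0 //.
  exact: lt_le_trans (expR_gt0 _) h.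
have l1 := lnge _ _ qbig; have l2 := lnge _ _ l1; have l3 := lnge _ _ l2.
have lq : 0 < ln (q%:R : R) by exact: lt_le_trans (expR_gt0 _) l1.
move: hS uL; set S := \sum_(p <- _) _; set L := ln (ln (q%:R : R)) => hS uL.
have S60 : 60 <= S by move: hS l3; rewrite -/L; lra.
have L1 : 1 <= L by move: l2; rewrite -/L; have := expR_ge1Dx (1 : R); lra.
have lnz : ln z = 100^-1 * S by rewrite /z ln_zparam.
have z0 : 0 < z.
  by case: (ltP 0 z) => // /ln0; rewrite lnz; lra.
have S8L : S <= 8 * L.
  by have := sum_lnp_primes_total R q lq ltac:(rewrite -/L; lra); rewrite -/L -/S; lra.
have r8 : 1 / 8 <= L / S by rewrite ler_pdivlMr //; lra.
have {}uL : 100 * 100 * 100 * (L / S) ^+ 3 <= u.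
  apply: le_trans uL; rewrite lnz mul1r le_eqVlt; apply/orP; left; apply/eqP.
  by field; lra.
(* As L / S >= 1 / 8, a lower bound for u by (L / S)^3 also gives absolute and
   linear lower bounds. *)
have r3 : (1 / 8) ^+ 2 * (L / S) <= (L / S) ^+ 3.
  rewrite [leRHS]exprSr ler_wpM2r //; first by lra.
  by apply: lerXn2r => //; rewrite nnegrE; lra.
have u32 : 32 <= u by lra.
have rle : 64 * (L / S) <= u by lra.
have lnu : ln u <= S / 200.
  have h : u ^+ 2 <= z.
    rewrite -[leRHS](sqr_sqrtr (ltW z0)).
    by apply: lerXn2r => //; rewrite nnegrE ?sqrtr_ge0 //; lra.
  have : ln (u ^+ 2) <= ln z by rewrite ler_ln ?posrE // exprn_gt0; lra.
  rewrite lnXn; last by lra.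
  by rewrite lnz mulr2n; lra.
have zu : z `^ u = expR (u * (S / 100)).
  by rewrite /powR gt_eqF // lnz; congr expR; lra.
have [Ip [xp Ipx [xp1 xp2]]] := exists_deviating_interval R q u true
  sq lq S60 L1 u32 rle lnu.
have [Im [xm Imx [xm1 xm2]]] := exists_deviating_interval R q u false
  sq lq S60 L1 u32 rle lnu.
exists Ip, Im; rewrite Ipx Imx zu !lee_fin !ltry xp1 xm1 /=; split => //.
- by move: xp2; rewrite expr1 -/S; lra.
- by move: xm2; rewrite expr0 -/S; lra.
Qed.
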